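(* Let $\mathbb{K}$ be a field of characteristic $0$, let $m\neq n$ be positive integers with $\min(m,n)\geq 2$, and let $J,J'\in Mat(m\times n,\mathbb{K})$. The Lie algebras $\left(Mat(n\times m,\mathbb{K}),[\cdot,\cdot]_J\right)$ and $\left(Mat(n\times m,\mathbb{K}),[\cdot,\cdot]_{J'}\right)$ are isomorphic if and only if $J$ and $J'$ are equivalent in $Mat(m\times n,\mathbb{K})$.
   Context: $Mat(n\times m,\mathbb{K})$ is the space of $n\times m$ matrices over $\mathbb{K}$. For $J\in Mat(m\times n,\mathbb{K})$, the Lie bracket $[\cdot,\cdot]_J$ on $Mat(n\times m,\mathbb{K})$ is $[A,B]_J=AJB-BJA$. Two matrices $J,J'\in Mat(m\times n,\mathbb{K})$ are called equivalent if there exist $Q\in GL(m,\mathbb{K})$ and $P\in GL(n,\mathbb{K})$ with $J=QJ'P$. *)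

(* Defs.v *)
From HB Require Import structures.
From mathcomp Require Import all_boot all_order all_algebra ring.

Set Implicit Arguments.
Unset Strict Implicit.
Unset Printing Implicit Defensive.

Import GRing.Theory.
Local Open Scope ring_scope.

Record lie_algebra (K : fieldType) := LieAlgebra {
  lie_carrier :> lmodType K;
  lie_br : lie_carrier -> lie_carrier -> lie_carrier;
  lie_br_linearl : forall y, linear (fun x => lie_br x y);
  lie_br_linearr : forall x, linear (lie_br x);
  lie_br_alt : forall x, lie_br x x = 0;
  lie_br_jacobi : forall x y z,
    lie_br x (lie_br y z) + lie_br y (lie_br z x) + lie_br z (lie_br x y) = 0
}.

Definition lie_isomorphic (K : fieldType) (L L' : lie_algebra K) : Prop :=
  exists f : {linear L -> L'},
    bijective f /\ forall x y : L, f (lie_br x y) = lie_br (f x) (f y).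

Definition mx_br (K : fieldType) (m n : nat) (J : 'M[K]_(m, n))
    (A B : 'M[K]_(n, m)) : 'M[K]_(n, m) :=
  A *m J *m B - B *m J *m A.

Lemma mx_br_linearl (K : fieldType) (m n : nat) (J : 'M[K]_(m, n)) B :
  linear (fun A => mx_br J A B).
Proof.
move=> a A A'; rewrite /mx_br !mulmxDl mulmxDr -!scalemxAl -scalemxAr.
by rewrite opprD addrACA scalerBr.
Qed.

Lemma mx_br_linearr (K : fieldType) (m n : nat) (J : 'M[K]_(m, n)) A :
  linear (mx_br J A).
Proof.
move=> a B B'; rewrite /mx_br !mulmxDl mulmxDr -!scalemxAl -scalemxAr.
by rewrite opprD addrACA scalerBr.
Qed.

Lemma mx_br_alt (K : fieldType) (m n : nat) (J : 'M[K]_(m, n)) A :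
  mx_br J A A = 0.
Proof. exact: subrr. Qed.

Lemma mx_br_jacobi (K : fieldType) (m n : nat) (J : 'M[K]_(m, n)) A B C :
  mx_br J A (mx_br J B C) + mx_br J B (mx_br J C A)
    + mx_br J C (mx_br J A B) = 0.
Proof.
rewrite /mx_br !mulmxBr !mulmxBl !mulmxA.
move: (A *m _ *m _ *m _ *m C) (A *m _ *m _ *m _ *m B).
move: (B *m _ *m _ *m _ *m A) (C *m _ *m _ *m _ *m A).
move: (B *m _ *m _ *m _ *m C) (C *m _ *m _ *m _ *m B) => a b c d e g.
by apply/matrixP=> i j; rewrite !mxE; ring.
Qed.

Definition mx_lie (K : fieldType) (m n : nat) (J : 'M[K]_(m, n)) :
    lie_algebra K :=
  LieAlgebra (mx_br_linearl J) (mx_br_linearr J) (mx_br_alt J)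
    (mx_br_jacobi J).

Definition mx_equivalent (K : fieldType) (m n : nat) (J J' : 'M[K]_(m, n)) :
    Prop :=
  exists Q : 'M[K]_m, exists P : 'M[K]_n,
    [/\ Q \in unitmx, P \in unitmx & J = Q *m J' *m P].

(* Main.v *)
(** Since [m <> n], the centre of [(Mat(n x m), [.,.]_J)] is
    [{A | J A = 0 and A J = 0}]: testing centrality on matrix units shows that
    [A J] and [J A] are scalar with the same scalar, which must vanish as their
    rank is at most [min m n]. Up to equivalence [J] is [pid_mx r] with [r] its
    rank, and the centre of [pid_mx r] strictly decreases as [r] grows. Hence
    the dimension of the centre, an isomorphism invariant, determines the rank
    of [J], that is, its equivalence class. *)
Require Import Defs.
From mathcomp Require Import all_boot all_order all_algebra.

Set Implicit Arguments.
Unset Strict Implicit.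
Unset Printing Implicit Defensive.

Import GRing.Theory.
Local Open Scope ring_scope.

Lemma mx_equivalent_pid (K : fieldType) (m n : nat) (J : 'M[K]_(m, n)) :
  mx_equivalent J (pid_mx (\rank J)).
Proof.
exists (col_ebase J), (row_ebase J).
by rewrite col_ebase_unit row_ebase_unit mulmx_ebase.
Qed.

(** Both matrices reduce to the same normal form [pid_mx]; one reduction is composed with the
    inverse of the other. *)
Lemma mx_equivalent_rank (K : fieldType) (m n : nat) (J J' : 'M[K]_(m, n)) :
  \rank J = \rank J' -> mx_equivalent J J'.
Proof.
move=> eq_rank; have [Q [P [uQ uP defJ]]] := mx_equivalent_pid J.
have [Q' [P' [uQ' uP' defJ']]] := mx_equivalent_pid J'.
exists (Q *m invmx Q'), (invmx P' *m P); split.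
- by rewrite unitmx_mul uQ unitmx_inv.
- by rewrite unitmx_mul uP unitmx_inv uP'.
have pidE : invmx Q' *m J' *m invmx P' = pid_mx (\rank J').
  by rewrite {1}defJ' !mulmxA mulVmx // mul1mx mulmxK.
by rewrite {1}defJ eq_rank -pidE !mulmxA.
Qed.

Lemma mx_equivalent_lie_isomorphic (K : fieldType) (m n : nat)
    (J J' : 'M[K]_(m, n)) :
  mx_equivalent J J' -> lie_isomorphic (mx_lie J) (mx_lie J').
Proof.
move=> [Q [P [uQ uP ->]]].
(* If [J = Q J' P], then [P (A J B) Q = (P A Q) J' (P B Q)], so [A |-> P A Q] respects the
   brackets. *)
pose f : {linear 'M[K]_(n, m) -> 'M[K]_(n, m)} := mulmxr Q \o mulmx P.
exists f; split.
  exists (fun A => invmx P *m A *m invmx Q) => A /=.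
    by rewrite !mulmxA mulmxK // mulVmx // mul1mx.
  by rewrite !mulmxA mulmxKV // mulmxV // mul1mx.
by move=> A B; rewrite /= /mx_br mulmxBr mulmxBl !mulmxA.
Qed.

(** This two-sided annihilator of [J] is a subspace by construction, hence has a [\dim]. It can be
    smaller than the centre when [m = n]: if [J] is invertible, its inverse is central too. *)
Definition mx_center (K : fieldType) (m n : nat) (J : 'M[K]_(m, n)) :
    {vspace 'M[K]_(n, m)} :=
  (lker (linfun (mulmx J : 'M_(n, m) -> 'M_m)) :&:
   lker (linfun (mulmxr J : 'M_(n, m) -> 'M_n)))%VS.

Lemma mem_mx_center (K : fieldType) (m n : nat) (J : 'M[K]_(m, n)) A :
  (A \in mx_center J) = (J *m A == 0) && (A *m J == 0).
Proof. by rewrite memv_cap !memv_ker !lfunE. Qed.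

Lemma mx_centerP (K : fieldType) (m n : nat) (J : 'M[K]_(m, n)) A :
  (0 < m)%N -> (0 < n)%N -> m <> n ->
  reflect (forall B, mx_br J A B = 0) (A \in mx_center J).
Proof.
move=> m_gt0 n_gt0 neq_mn; rewrite mem_mx_center.
apply: (iffP andP) => [[/eqP JA0 /eqP AJ0] B | centA].
  by rewrite /mx_br AJ0 -mulmxA JA0 mul0mx mulmx0 subrr.
(* This is entry [(i, j)] of [A J E = E J A], with [E] the matrix unit at [(k, l)]. *)
have comm i j k l :
    (A *m J) i k *+ (j == l) = (J *m A) l j *+ (i == k).
  have /matrixP/(_ i j) := subr0_eq (centA (delta_mx k l)).
  rewrite -[_ *m J *m A]mulmxA !mxE (bigD1 k) //= big1 => [|k' /negPf nek].
    rewrite (bigD1 l) //= big1 => [|l' /negPf nel].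
      by rewrite !mxE !eqxx andbT /= !addr0 mulr_natr mulr_natl.
    by rewrite !mxE nel andbF mul0r.
  by rewrite !mxE nek mulr0.
pose i0 := Ordinal n_gt0; pose j0 := Ordinal m_gt0.
set a := (A *m J) i0 i0.
have AJ : A *m J = a%:M.
  apply/matrixP=> i k; have := comm i j0 k j0.
  rewrite eqxx mulr1n => ->; rewrite [RHS]mxE; congr (_ *+ _).
  by have := comm i0 j0 i0 j0; rewrite !eqxx !mulr1n.
have JA : J *m A = a%:M.
  apply/matrixP=> l j; have := comm i0 j i0 l.
  by rewrite eqxx mulr1n => <-; rewrite [RHS]mxE eq_sym.
have [a0 | nz_a] := eqVneq a 0.
  by rewrite JA AJ a0 !raddf0.
(* With [a] nonzero, [A J] has rank [n] and factors through dimension [m], while [J A] has rank [m]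
   and factors through dimension [n]. *)
case: neq_mn; apply/eqP; rewrite eqn_leq.
have := mulmx_max_rank A J; have := mulmx_max_rank J A.
have rank_scalar p : \rank (a%:M : 'M[K]_p) = p.
  by rewrite -scalemx1 mxrank_scale_nz // mxrank1.
by rewrite AJ JA !rank_scalar => -> ->.
Qed.

Lemma dim_mx_center_iso (K : fieldType) (m n : nat) (J J' : 'M[K]_(m, n)) :
  (0 < m)%N -> (0 < n)%N -> m <> n ->
  lie_isomorphic (mx_lie J) (mx_lie J') ->
  \dim (mx_center J) = \dim (mx_center J').
Proof.
move=> m_gt0 n_gt0 neq_mn [/= f [[g fK gK] fM]].
(* The carrier of a [lie_algebra] is only an [lmodType]; retyping [f] on matrices gives access to
   [linfun] and dimensions. *)
pose h : {linear 'M[K]_(n, m) -> 'M[K]_(n, m)} := f.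
have ker_h : lker (linfun h) = 0%VS.
  apply/eqP/lker0P => A B; rewrite !lfunE /=; exact: (can_inj fK).
rewrite -(limg_dim_eq (f := linfun h)); last by rewrite ker_h capv0.
congr (\dim _); apply/vspaceP=> A.
apply/memv_imgP/idP => [[B /mx_centerP centB ->] | /mx_centerP centA].
  rewrite lfunE; apply/mx_centerP => // C.
  by rewrite -(gK C) -[LHS]fM /= centB // [LHS]raddf0.
exists (g A); last by rewrite lfunE /= [RHS]gK.
apply/mx_centerP => // B; apply: (can_inj fK).
by rewrite [RHS]raddf0 [LHS]fM gK; apply: centA.
Qed.

Lemma dim_mx_center_pid (K : fieldType) (m n r s : nat) :
  (r < s)%N -> (s <= m)%N -> (s <= n)%N ->
  (\dim (mx_center (pid_mx s : 'M[K]_(m, n)))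
     < \dim (mx_center (pid_mx r : 'M[K]_(m, n))))%N.
Proof.
move=> lt_rs le_sm le_sn; set Zs := mx_center _; set Zr := mx_center _.
have sub_sr : (Zs <= Zr)%VS.
  apply/subvP=> A; rewrite !mem_mx_center => /andP[/eqP sA /eqP As].
  have le_rs := ltnW lt_rs.
  (* Factoring [pid_mx r] through [pid_mx s] on either side shows that whatever [pid_mx s]
     annihilates, [pid_mx r] does too. *)
  have -> : (pid_mx r : 'M[K]_(m, n)) = (pid_mx r : 'M_m) *m pid_mx s.
    by rewrite mul_pid_mx (minn_idPl le_rs) (minn_idPr (leq_trans le_rs le_sm)).
  rewrite -mulmxA sA mulmx0 eqxx /=.
  have -> : (pid_mx r : 'M[K]_m) *m pid_mx s = pid_mx s *m (pid_mx r : 'M[K]_n).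
    by rewrite !mul_pid_mx (minnC s) (minn_idPl le_rs)
      (minn_idPr (leq_trans le_rs le_sm)) (minn_idPr (leq_trans le_rs le_sn)).
  by rewrite mulmxA As mul0mx.
rewrite ltn_neqAle dimvS // andbT; apply/negP => /eqP eq_dim.
have/eqP eqZ : Zs == Zr by rewrite eqEdim sub_sr eq_dim /=.
(* Both indices have value [r], counted from 0: the first diagonal position beyond the ones of
   [pid_mx r], still among those of [pid_mx s]. The matrix unit there makes the inclusion strict. *)
pose i := Ordinal (leq_trans lt_rs le_sn).
pose j := Ordinal (leq_trans lt_rs le_sm).
have : delta_mx i j \in Zr.
  rewrite mem_mx_center; apply/andP; split; apply/eqP/matrixP => k l;
    rewrite !mxE big1 // => x _; rewrite !mxE.
    have [-> | _] := eqVneq x i; last by rewrite mulr0.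
    by have [-> /= | _] := eqVneq (k : nat) i; rewrite ?ltnn mul0r.
  have [-> | _] := eqVneq x j; last by rewrite andbF mul0r.
  by rewrite /= ltnn andbF mulr0.
rewrite -eqZ mem_mx_center => /andP[/eqP/matrixP/(_ j j)/eqP].
rewrite !mxE (bigD1 i) //= big1 => [|x /negPf nex].
  by rewrite !mxE !eqxx lt_rs mulr1 addr0 oner_eq0.
by rewrite !mxE nex mulr0.
Qed.

Lemma dim_mx_center_rank (K : fieldType) (m n : nat) (J J' : 'M[K]_(m, n)) :
  (0 < m)%N -> (0 < n)%N -> m <> n ->
  \dim (mx_center J) = \dim (mx_center J') -> \rank J = \rank J'.
Proof.
move=> m_gt0 n_gt0 neq_mn.
(* Equivalence to the normal form gives a Lie isomorphism, which preserves the dimension of the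
   centre. *)
have dimE (M : 'M[K]_(m, n)) :
    \dim (mx_center M) = \dim (mx_center (pid_mx (\rank M) : 'M[K]_(m, n))).
  apply: dim_mx_center_iso => //.
  exact/mx_equivalent_lie_isomorphic/mx_equivalent_pid.
rewrite (dimE J) (dimE J') => eq_dim.
case: (ltngtP (\rank J) (\rank J')) => // lt_rank.
  have := dim_mx_center_pid K lt_rank (rank_leq_row J') (rank_leq_col J').
  by rewrite eq_dim ltnn.
have := dim_mx_center_pid K lt_rank (rank_leq_row J) (rank_leq_col J).
by rewrite eq_dim ltnn.
Qed.

Theorem theorem4p3 (K : fieldType) (charK : [pchar K] =i pred0)
    (m n : nat) (m_gt0 : (0 < m)%N) (n_gt0 : (0 < n)%N) (neq_mn : m <> n)
    (min_mn : (2 <= minn m n)%N) (J J' : 'M[K]_(m, n)) :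
  lie_isomorphic (mx_lie J) (mx_lie J') <-> mx_equivalent J J'.
Proof.
split=> [isoJ | ]; last exact: mx_equivalent_lie_isomorphic.
by apply/mx_equivalent_rank/dim_mx_center_rank/dim_mx_center_iso.
Qed.
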